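(* Let $n>1$ be a squarefree integer. Let $d$ be a positive integer and $\zeta_d\in\mathbb{C}$ a primitive $d$-th root of unity such that $F_n(\zeta_d)=0$. Then: (1) if $d\neq 4$, then $\zeta_d$ is a simple root of $F_n$; (2) if $d=4$ and $n$ is odd, then $\zeta_d$ is a simple root of $F_n$; (3) if $d=4$ and $n$ is even, then $\zeta_d$ is a double root of $F_n$ (i.e. a root of multiplicity exactly $2$).
   Context: For an integer $n>1$, $F_n(x)=\sum_{0\le a\le n-1,\ \gcd(a,n)=1}x^a\in\mathbb{Z}[x]$. *)

(* Defs.v *)
From mathcomp Require Import all_boot all_order all_algebra.
From mathcomp Require Import complex reals.

Set Implicit Arguments.
Unset Strict Implicit.
Unset Printing Implicit Defensive.

Import GRing.Theory Num.Theory.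
Local Open Scope ring_scope.

Definition squarefree (n : nat) : Prop :=
  forall m : nat, (m ^ 2 %| n)%N -> m = 1%N.

Definition coprime_poly (n : nat) : {poly int} :=
  \sum_(0 <= a < n | coprime a n) 'X^a.

(* Main.v *)
Require Import Defs.
From HB Require Import structures.
From mathcomp Require Import all_boot all_order all_algebra.
From mathcomp Require Import all_solvable all_field.
From mathcomp Require Import complex reals ring.

(** Write F_n for [coprime_poly n].  By Moebius inversion,
    F_n = (X^n - 1) G_n with G_n = \sum_(e | n) mu(e) / (X^e - 1).
    Let theta = X d/dX and let z be a primitive d-th root of unity with
    F_n(z) = 0.

    If d divides the squarefree n, then F_n(z) is up to sign F_(n/d)(1), a
    value of the totient function, hence nonzero
    ([squarefree_primitive_root_dvd]).  So d does not divide n, z ^+ n <> 1, and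
    z is a multiple root of F_n exactly when H_n := theta G_n vanishes at z
    ([coprime_poly_msum]).

    Suppose that z is a multiple root.  All primitive d-th roots of unity are
    conjugate over the rationals ([root_conjugate]), so H_n vanishes at all of
    them.  For a prime p not dividing m, H_(pm)(x) = H_m(x) - p H_m(x^p), and
    the sum of H_m(x w) over the p-th roots of unity w is p^2 H_m(x^p)
    ([msum_distribution]).  These two facts show that, when p^2 does not divide
    d, the vanishing of H_(pm) at all primitive d-th roots implies that of H_m
    ([msum_strip_prime]).  After stripping all such primes there remains the
    product N of the primes p | n with p^2 | d, and N^2 | d.
    - If N = 1, then H_1 = - x / (x - 1)^2 would vanish at z, which is absurd.
    - If N > 1, then z w is a primitive d-th root for every N-th root of unity
      w, so the sum of w^-1 H_N(z w) is 0.  This sum isolates the coefficient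
      of z in the expansion of H_1(z) on 1, z, ..., z^(N-1) with coefficients
      in the rational functions of z^N ([msum_twisted_sum]); its vanishing
      reads 1 + (N - 1) z^N = 0.  Taking absolute values gives N = 2, then
      z^2 = -1 and d = 4 ([msum_square_primes]).
    Hence z is a simple root unless d = 4 and n is even.

    In that last case z^2 = -1, and H_n(z) = 0 follows from H_2(z) = 0, while
    theta^2 G_n(z) is a product of z / 2 and of factors 1 - (+/- p^2) over the
    odd primes p | n, so it is nonzero ([msum1_order4], [msum2_order4]), and z
    is exactly a double root. *)

Set Implicit Arguments.
Unset Strict Implicit.
Unset Printing Implicit Defensive.
Import Order.TTheory GRing.Theory Num.Theory.
Local Open Scope ring_scope.

(** * The recursion for coprime polynomials *)

Lemma coprime_poly1 : coprime_poly 1 = 1.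
Proof. by rewrite /coprime_poly big_mkord big_mkcond big_ord1 /= expr0. Qed.

Lemma coprime_poly_periodic m k :
  (\sum_(0 <= a < k * m | coprime a m) 'X^a) * ('X^m - 1)
  = coprime_poly m * ('X^(k * m) - 1) :> {poly int}.
Proof.
elim: k => [|k IHk].
  by rewrite mul0n big_geq // mul0r expr0 subrr mulr0.
rewrite (@big_cat_nat _ _ _ (k * m)) //=; last by rewrite mulSn leq_addl.
rewrite mulrDl IHk -{2}[(k * m)%N]add0n big_addn mulSn addnK.
have -> : \sum_(0 <= i < m | coprime (i + k * m) m) 'X^(i + k * m)
   = coprime_poly m * 'X^(k * m) :> {poly int}.
  rewrite /coprime_poly big_distrl /=; apply: eq_big => [i|i _].
    by rewrite addnC /coprime gcdnC gcdnMDl gcdnC.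
  by rewrite exprD.
by rewrite exprD; ring.
Qed.

Lemma big_nat_dvd (V : nmodType) (Q : pred nat) (phi : nat -> V) p m :
  (0 < p)%N ->
  \sum_(0 <= a < (p * m)%N | (p %| a)%N && Q a) phi a
  = \sum_(0 <= b < m | Q (p * b)%N) phi (p * b)%N.
Proof.
move=> p_gt0; elim: m => [|m IHm]; first by rewrite muln0 !big_geq.
rewrite (@big_cat_nat _ _ _ (p * m)) //=; last by rewrite leq_mul.
rewrite IHm [in RHS]big_mkcond big_nat_recr //= -big_mkcond; congr (_ + _).
rewrite big_mkcond big_ltn ?ltn_pmul2l // dvdn_mulr //= big_nat big1 ?addr0 //.
move=> i /andP[lt_i gt_i]; case: ifP => // /andP[/dvdnP[b def_i] _].
move: lt_i gt_i; rewrite def_i [(b * p)%N]mulnC !ltn_pmul2l //.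
by rewrite ltnS ltnNge => /negbTE->.
Qed.

(** Among the exponents below p m and prime to m, those prime to p m are the
    ones not divisible by p; the others are p b, with b < m prime to m. *)
Lemma coprime_poly_mul_prime p m : prime p -> coprime p m ->
  coprime_poly (p * m) * ('X^m - 1)
  = coprime_poly m * ('X^(p * m) - 1) - (coprime_poly m \Po 'X^p) * ('X^m - 1).
Proof.
move=> p_pr co_pm; have p_gt0 := prime_gt0 p_pr.
rewrite -coprime_poly_periodic -mulrBl; congr (_ * _).
have -> : coprime_poly m \Po 'X^p
   = \sum_(0 <= a < p * m | (p %| a)%N && coprime a m) 'X^a.
  rewrite big_nat_dvd // /coprime_poly raddf_sum /=.
  apply: eq_big => [b|b _]; first by rewrite coprimeMl co_pm.
  by rewrite comp_Xn_poly exprM.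
rewrite /coprime_poly [X in _ = X - _](bigID (fun a => p %| a)%N) /=.
rewrite [X in _ = _ + _ - X]
  (eq_bigl (fun a => coprime a m && (p %| a)%N)); last first.
  by move=> a; rewrite andbC.
rewrite addrAC subrr add0r; apply: eq_bigl => a.
by rewrite coprimeMr [coprime a p]coprime_sym prime_coprime // andbC.
Qed.

(** * Moebius sums and the Euler operator *)

(** For a list s of distinct primes with product n, [msum w phi s x] is
    \sum_(e | n) mu(e) e^w phi(x^e).  Peeling the primes off one by one is the
    form in which these sums are used, so this is taken as the definition. *)
Fixpoint msum (K : pzRingType) (w : nat) (phi : K -> K) (s : seq nat) (x : K) :=
  if s is p :: s' then msum w phi s' x - p%:R ^+ w * msum w phi s' (x ^+ p)
  else phi x.

(** The derivation X d/dX, under which X^n is an eigenvector.  It is locked to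
    keep rewriting with the product rule from unfolding iterates of it. *)
HB.lock Definition euler_op (K : nzRingType) (P : {poly K}) : {poly K} :=
  'X * P^`().

Section EulerOp.
Variable K : comNzRingType.
Implicit Types P Q : {poly K}.

Lemma euler_opB P Q : euler_op (P - Q) = euler_op P - euler_op Q.
Proof. by rewrite !euler_op.unlock derivB mulrBr. Qed.

Lemma euler_opD P Q : euler_op (P + Q) = euler_op P + euler_op Q.
Proof. by rewrite !euler_op.unlock derivD mulrDr. Qed.

Lemma euler_opM P Q : euler_op (P * Q) = euler_op P * Q + P * euler_op Q.
Proof. by rewrite !euler_op.unlock derivM; ring. Qed.

Lemma euler_opXn n : euler_op 'X^n = n%:R * 'X^n :> {poly K}.
Proof.
case: n => [|n]; first by rewrite !euler_op.unlock expr0 derivC mulr0 mul0r.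
by rewrite !euler_op.unlock derivXn /= mulr_natl exprS mulrnAr.
Qed.

Lemma euler_op1 : euler_op 1 = 0 :> {poly K}.
Proof. by rewrite !euler_op.unlock derivC mulr0. Qed.

Lemma euler_op0 : euler_op 0 = 0 :> {poly K}.
Proof. by rewrite !euler_op.unlock deriv0 mulr0. Qed.

Lemma horner_natr n x : (n%:R : {poly K}).[x] = n%:R.
Proof. by rewrite -polyC_natr hornerC. Qed.

Lemma euler_op_natr n P : euler_op (n%:R * P) = n%:R * euler_op P.
Proof. by rewrite !euler_op.unlock !mulr_natl derivMn mulrnAr. Qed.

Lemma euler_op_comp_Xn n P :
  (0 < n)%N -> euler_op (P \Po 'X^n) = n%:R * (euler_op P \Po 'X^n).
Proof.
case: n => // n _.
rewrite !euler_op.unlock deriv_comp derivXn /= comp_polyM comp_polyX.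
by rewrite -mulr_natl exprS; ring.
Qed.

End EulerOp.

Section MoebiusSums.
Variable K : fieldType.
Implicit Types (x : K) (s : seq nat).

(** [pole], [pole1] and [pole2] are 1 / (x - 1) and its images under X d/dX and
    (X d/dX)^2.  Applied to phi(x^e), X d/dX produces a factor e, whence the
    weights 0, 1 and 2 of the corresponding Moebius sums. *)
Definition pole x : K := (x - 1)^-1.
Definition pole1 x : K := - (x / (x - 1) ^+ 2).
Definition pole2 x : K := x * (x + 1) / (x - 1) ^+ 3.

(** The identity F_n = (X^n - 1) G_n and its first two images under X d/dX,
    evaluated at a point outside the poles of G_n. *)
Lemma coprime_poly_msum s x (n := (\prod_(p <- s) p)%N)
    (F : {poly K} := map_poly intr (coprime_poly n)) :
  uniq s -> all prime s -> x ^+ n != 1 ->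
  [/\ F.[x] = (x ^+ n - 1) * msum 0 pole s x,
      (euler_op F).[x] = n%:R * x ^+ n * msum 0 pole s x
                         + (x ^+ n - 1) * msum 1 pole1 s x
    & (euler_op (euler_op F)).[x]
      = n%:R ^+ 2 * x ^+ n * msum 0 pole s x
        + 2%:R * n%:R * x ^+ n * msum 1 pole1 s x
        + (x ^+ n - 1) * msum 2 pole2 s x].
Proof.
rewrite {}/F {}/n; elim: s x => [|p s IHs] x /=.
  move=> _ _; rewrite big_nil expr1 -subr_eq0 => x1.
  rewrite coprime_poly1 rmorph1 euler_op1 euler_op0 hornerC horner0.
  by rewrite /pole /pole1 /pole2; split; field.
move=> /andP[p_s s_uniq] /andP[p_pr s_pr]; rewrite big_cons.
set m := (\prod_(q <- s) q)%N => xpm.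
have p_gt0 := prime_gt0 p_pr.
have co_pm : coprime p m.
  rewrite prime_coprime // /m big_seq; elim/big_ind: _ => [|a b pa pb|q q_s].
  - by rewrite Euclid_dvd1.
  - by rewrite Euclid_dvdM // negb_or pa.
  - by rewrite dvdn_prime2 // ?(allP s_pr) //; apply: contraNneq p_s => ->.
have xm : x ^+ m != 1 by apply: contraNneq xpm; rewrite mulnC exprM => ->; rewrite expr1n.
have [B0 B1 B2] := IHs x s_uniq s_pr xm.
have [] := IHs (x ^+ p) s_uniq s_pr; first by rewrite -exprM.
rewrite -!exprM -/m => D0 D1 D2.
have /(congr1 (map_poly (intr : int -> K))) := coprime_poly_mul_prime p_pr co_pm.
rewrite rmorphB !rmorphM !rmorphB /= !rmorph1 !map_polyXn map_comp_poly map_polyXn /=.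
set A := map_poly _ (coprime_poly (p * m)).
set B := map_poly _ _ in B0 B1 B2 D0 D1 D2 *.
move=> e0.
have /(congr1 (@euler_op _)) := e0.
rewrite !(euler_opM, euler_opB) !euler_opXn !euler_op1 euler_op_comp_Xn // => e1.
have /(congr1 (@euler_op _)) := e1.
rewrite !(euler_op_natr, euler_opM, euler_opB, euler_opD) !euler_opXn !euler_op1.
rewrite ?euler_op_comp_Xn // => e2.
move: (congr1 (horner^~ x) e0) (congr1 (horner^~ x) e1) (congr1 (horner^~ x) e2).
move: B0 B1 B2 D0 D1 D2 {e0 e1 e2}; rewrite -/m natrM.
move: (euler_op (euler_op A)) (euler_op (euler_op B)) => A2 B2.
clearbody A B; move: (euler_op A) (euler_op B) => A1 B1.
rewrite !(hornerD, hornerN, hornerM, horner_comp, hornerXn, horner_natr) ?hornerE /=.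
move: (x ^+ (p * m)) (x ^+ m) xm => P M M1.
move=> -> -> -> -> -> ->; move: M1; rewrite -subr_eq0 => M1 e0 e1 e2.
rewrite euler_op0 horner0 in e2.
have a0 : A.[x] = (P - 1) * (msum 0 pole s x - msum 0 pole s (x ^+ p)).
  by apply: (mulIf M1); rewrite e0; ring.
rewrite a0 !subr0 in e1 e2.
have a1 : A1.[x] = p%:R * m%:R * P * (msum 0 pole s x - msum 0 pole s (x ^+ p))
    + (P - 1) * (msum 1 pole1 s x - p%:R * msum 1 pole1 s (x ^+ p)).
  by apply: (mulIf M1); rewrite (canRL (addrK _) e1); ring.
rewrite a1 in e2.
split=> //.
apply: (mulIf M1); apply: subr0_eq.
by move/eqP: e2; rewrite -subr_eq0 => /eqP e2; rewrite -[RHS]e2; ring.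
Qed.
End MoebiusSums.
Arguments pole {K} x.
Arguments pole1 {K} x.
Arguments pole2 {K} x.

(** * Sums over roots of unity *)

Section RootsOfUnity.
Variable K : fieldType.
Implicit Types (x z w : K) (s : seq nat) (phi : K -> K).

Section Order.
Variables (N : nat) (w : K).
Hypothesis w_prim : N.-primitive_root w.

Lemma sum_unity_roots_shift phi j :
  \sum_(i < N) phi (w ^+ i * w ^+ j) = \sum_(i < N) phi (w ^+ i).
Proof.
have N_gt0 := prim_order_gt0 w_prim.
pose h (i : 'I_N) := Ordinal (ltn_pmod (i + j) N_gt0).
have h_inj : injective h.
  move=> a b /(congr1 val)/eqP /=; rewrite eqn_modDr !modn_small //.
  by move=> /eqP/val_inj.
rewrite [RHS](reindex_inj h_inj); apply: eq_bigr => i _ /=.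
by rewrite -exprD prim_expr_mod.
Qed.

Lemma sum_unity_roots_expr phi q : coprime q N ->
  \sum_(i < N) phi (w ^+ i ^+ q) = \sum_(i < N) phi (w ^+ i).
Proof.
move=> co_qN; have N_gt0 := prim_order_gt0 w_prim.
pose h (i : 'I_N) := Ordinal (ltn_pmod (i * q) N_gt0).
have h_inj : injective h.
  move=> a b /(congr1 val) /= /eqP; rewrite -(eq_prim_root_expr w_prim).
  rewrite ![(_ * q)%N]mulnC !exprM.
  have wq_prim : N.-primitive_root (w ^+ q) by rewrite prim_root_exp_coprime.
  by rewrite (eq_prim_root_expr wq_prim) !modn_small // => /eqP/val_inj.
rewrite [RHS](reindex_inj h_inj); apply: eq_bigr => i _ /=.
by rewrite -exprM prim_expr_mod.
Qed.

(** Here w ^+ i ^+ N.-1 is the inverse of w ^+ i.  Multiplying the summation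
    variable by the p-th root of unity w ^+ (N / p) does not change
    (x * w ^+ i) ^+ p, but multiplies the sum by a number other than 1. *)
Lemma sum_unity_roots_twist_expr phi x p : (p %| N)%N -> (1 < p)%N ->
  \sum_(i < N) w ^+ i ^+ N.-1 * phi ((x * w ^+ i) ^+ p) = 0.
Proof.
move=> /dvdnP[M def_N] p_gt1; have N_gt0 := prim_order_gt0 w_prim.
set S := LHS.
have : S = w ^+ M ^+ N.-1 * S.
  rewrite {1}/S -(sum_unity_roots_shift (fun u => u ^+ N.-1 * phi ((x * u) ^+ p)) M).
  rewrite big_distrr; apply: eq_bigr => i _ /=.
  rewrite [RHS]mulrA; congr (_ * phi _); first by rewrite exprMn mulrC.
  rewrite mulrA [LHS]exprMn -[w ^+ M ^+ p]exprM -def_N.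
  by rewrite (prim_expr_order w_prim) mulr1.
move/eqP; rewrite -subr_eq0 -{1}[S]mul1r -mulrBl mulf_eq0 => /orP[|/eqP//].
rewrite subr_eq0 -exprM eq_sym -(prim_order_dvd w_prim).
rewrite Gauss_dvdl ?coprimenP // => /dvdn_leq.
have M_gt0 : (0 < M)%N by move: N_gt0; rewrite def_N muln_gt0 => /andP[].
by move=> /(_ M_gt0); rewrite def_N leqNgt ltn_Pmulr.
Qed.

Lemma sum_unity_roots_expn k :
  \sum_(i < N) (w ^+ i) ^+ k = if (N %| k)%N then N%:R else 0.
Proof.
rewrite (eq_bigr (fun i : 'I_N => (w ^+ k) ^+ i)); last first.
  by move=> i _; rewrite -!exprM mulnC.
case: ifP => [|N_k]; first rewrite (prim_order_dvd w_prim) => /eqP ->.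
  by rewrite (eq_bigr (fun=> 1)) ?sumr_const ?card_ord // => i _; rewrite expr1n.
have wk1 : w ^+ k - 1 != 0 by rewrite subr_eq0 -(prim_order_dvd w_prim) N_k.
apply: (mulfI wk1); rewrite -subrX1 mulr0 -exprM mulnC exprM.
by rewrite (prim_expr_order w_prim) expr1n subrr.
Qed.
End Order.

(** The coefficient of x ^+ j in the expansion of [pole1 x] on 1, x, ...,
    x ^+ N.-1 over the rational functions of y = x ^+ N. *)
Definition pole1_coef N (y : K) j : K :=
  - (j%:R / (1 - y) + N%:R * y / (1 - y) ^+ 2).

Lemma pole1_expansion N x : x ^+ N != 1 ->
  pole1 x = \sum_(j < N) pole1_coef N (x ^+ N) j * x ^+ j.
Proof.
move=> xN; have x1 : x - 1 != 0.
  by rewrite subr_eq0; apply: contraNneq xN => ->; rewrite expr1n.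
(* Both sums are computed in closed form from (x - 1) S0 and (x - 1) S1. *)
pose S0 := \sum_(j < N) x ^+ j; pose S1 := \sum_(j < N) j%:R * x ^+ j.
have eS0 : (x - 1) * S0 = x ^+ N - 1 by rewrite -subrX1.
have eS1 : (x - 1) * S1 = N%:R * x ^+ N - x * S0.
  rewrite /S0 /S1; elim: (N) => [|M IHM]; first by rewrite !big_ord0 !mulr0 mul0r subrr.
  by rewrite !big_ord_recr /= mulrDr IHM exprS; ring.
have -> : \sum_(j < N) pole1_coef N (x ^+ N) j * x ^+ j
   = - ((1 - x ^+ N)^-1 * S1 + N%:R * x ^+ N / (1 - x ^+ N) ^+ 2 * S0).
  rewrite /S0 /S1 !mulr_sumr -big_split -sumrN /=; apply: eq_bigr => j _.
  by rewrite /pole1_coef; ring.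
have y1 : 1 - x ^+ N != 0 by rewrite subr_eq0 eq_sym.
have -> : S0 = (x ^+ N - 1) / (x - 1) by rewrite -eS0 mulrC mulKf.
have -> : S1 = (N%:R * x ^+ N - x * ((x ^+ N - 1) / (x - 1))) / (x - 1).
  by rewrite -eS0 [_ * S0]mulrC mulfK // -eS1 mulrC mulKf.
by rewrite /pole1; field; rewrite x1.
Qed.

Lemma sum_pole1 N w x k : N.-primitive_root w -> x ^+ N != 1 ->
  \sum_(i < N) w ^+ i ^+ k * pole1 (x * w ^+ i)
  = \sum_(j < N) pole1_coef N (x ^+ N) j * x ^+ j
                 * (if (N %| k + j)%N then N%:R else 0).
Proof.
move=> w_prim xN.
have xw i : (x * w ^+ i) ^+ N = x ^+ N.
  by rewrite exprMn -exprM mulnC exprM (prim_expr_order w_prim) expr1n mulr1.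
under eq_bigr => i _ do rewrite (@pole1_expansion N) ?xw // mulr_sumr.
rewrite exchange_big; apply: eq_bigr => j _ /=.
rewrite -(sum_unity_roots_expn w_prim) mulr_sumr; apply: eq_bigr => i _.
by rewrite exprD exprMn; ring.
Qed.

Lemma pole1_distribution N w x : N.-primitive_root w -> x ^+ N != 1 ->
  \sum_(i < N) pole1 (x * w ^+ i) = N%:R ^+ 2 * pole1 (x ^+ N).
Proof.
move=> w_prim xN; have := sum_pole1 0 w_prim xN.
under eq_bigr do rewrite expr0 mul1r.
move->; case: N => [|N] in w_prim xN *; first by have := prim_order_gt0 w_prim.
rewrite big_ord_recl big1 /= => [|j _]; last first.
  by rewrite add0n gtnNdvd ?mulr0 // /bump /= add1n ltnS.
rewrite addr0 /pole1_coef /pole1 expr0.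
have y1 : x ^+ N.+1 - 1 != 0 by rewrite subr_eq0.
by field; rewrite y1 subr_eq0 eq_sym.
Qed.

(** Raising to the power of a prime q other than p permutes the p-th roots of
    unity, so the distribution relation of [pole1] passes to Moebius sums. *)
Lemma msum_distribution s p w x : p.-primitive_root w -> all (coprime^~ p) s ->
  x ^+ (p * \prod_(q <- s) q)%N != 1 ->
  \sum_(i < p) msum 1 pole1 s (x * w ^+ i) = p%:R ^+ 2 * msum 1 pole1 s (x ^+ p).
Proof.
move=> w_prim; elim: s x => [|q s IHs] x /=.
  by move=> _; rewrite big_nil muln1; apply: pole1_distribution.
rewrite big_cons => /andP[co_qp co_sp] xn.
rewrite sumrB -mulr_sumr IHs //; last first.
  by apply: contraNneq xn => xp; rewrite mulnCA mulnC exprM xp expr1n.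
under [X in _ - _ * X]eq_bigr => i _ do rewrite exprMn.
rewrite (sum_unity_roots_expr w_prim (fun u => msum 1 pole1 s (x ^+ q * u)) co_qp).
rewrite IHs //; last by rewrite -exprM mulnCA.
by rewrite -!exprM [(p * q)%N]mulnC; ring.
Qed.

(** Only the term e = 1 of the Moebius sum survives the twist, and in its
    expansion only the coefficient of index 1. *)
Lemma msum_twisted_sum s N w x : N.-primitive_root w -> (1 < N)%N ->
  all (fun p => (1 < p) && (p %| N))%N s -> x ^+ N != 1 ->
  \sum_(i < N) w ^+ i ^+ N.-1 * msum 1 pole1 s (x * w ^+ i)
  = N%:R * pole1_coef N (x ^+ N) 1 * x.
Proof.
move=> w_prim N_gt1 + xN; elim: s => [_|p s IHs] /=.
  rewrite sum_pole1 //; case: N w_prim N_gt1 xN => [|[|N]] // w_prim _ xN.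
  rewrite !big_ord_recl big1 /= => [|j _]; last first.
    rewrite /bump /= !add1n addnS -addSn dvdn_addr // gtnNdvd ?mulr0 //.
    by rewrite ltnS ltnS ltnW.
  rewrite addn0 gtnNdvd // mulr0 add0r addr0 /bump /= addn1 dvdnn; ring.
move=> /andP[/andP[p_gt1 p_N] /IHs IH].
under eq_bigr do rewrite mulrBr.
rewrite sumrB IH expr1 -[RHS]subr0; congr (_ - _).
under eq_bigr do rewrite mulrCA.
rewrite -mulr_sumr.
by rewrite (sum_unity_roots_twist_expr w_prim (msum 1 pole1 s) x p_N) // mulr0.
Qed.

Lemma prim_root_mul a b z w : coprime a b ->
  a.-primitive_root z -> b.-primitive_root w -> (a * b).-primitive_root (z * w).
Proof.
move=> co_ab z_prim w_prim.
have ab_gt0 : (0 < a * b)%N.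
  by rewrite muln_gt0 (prim_order_gt0 z_prim) (prim_order_gt0 w_prim).
have zw1 : (z * w) ^+ (a * b) = 1.
  rewrite exprMn exprM (prim_expr_order z_prim) expr1n mul1r mulnC exprM.
  by rewrite (prim_expr_order w_prim) expr1n.
have [k k_prim k_ab] := prim_order_exists ab_gt0 zw1.
suff -> : (a * b)%N = k by [].
apply/eqP; rewrite eqn_dvd k_ab andbT Gauss_dvd //.
have zwk := prim_expr_order k_prim.
apply/andP; split.
  rewrite -(@Gauss_dvdl _ _ b) // (prim_order_dvd z_prim).
  have /(congr1 (fun u => u ^+ b)) := zwk.
  rewrite exprMn expr1n exprMn -!exprM [X in w ^+ X]mulnC [X in _ * X]exprM.
  by rewrite (prim_expr_order w_prim) expr1n mulr1 => ->.
rewrite -(@Gauss_dvdl _ _ a) 1?coprime_sym // (prim_order_dvd w_prim).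
have /(congr1 (fun u => u ^+ a)) := zwk.
rewrite exprMn expr1n exprMn -!exprM [X in z ^+ X]mulnC [X in X * _]exprM.
by rewrite (prim_expr_order z_prim) expr1n mul1r => ->.
Qed.
End RootsOfUnity.

(** * Removing the primes whose square does not divide d *)

Section Stripping.
Variable C : numFieldType.
Implicit Types (h : C -> C) (z w : C).

(** Iterating the relation k = totient d times returns to z, because
    p ^ k = 1 modulo d; hence h z = p ^ k * h z. *)
Lemma prim_roots_dilation_eq0 h p d : (1 < p)%N -> coprime p d ->
  (forall z, d.-primitive_root z -> h z = p%:R * h (z ^+ p)) ->
  forall z, d.-primitive_root z -> h z = 0.
Proof.
move=> p_gt1 co_pd h_p z z_prim.
have h_pk k : h z = p%:R ^+ k * h (z ^+ (p ^ k)).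
  elim: k => [|k IHk]; first by rewrite expr0 mul1r expn0 expr1.
  rewrite IHk h_p; last by rewrite prim_root_exp_coprime // coprimeXl.
  by rewrite -exprM -expnSr exprS; ring.
have d_gt0 := prim_order_gt0 z_prim.
have := h_pk (totient d).
rewrite -(prim_expr_mod z_prim) (Euler_exp_totient co_pd) (prim_expr_mod z_prim) expr1.
move/eqP; rewrite -subr_eq0 -{1}[h z]mul1r -mulrBl mulf_eq0 => /orP[|/eqP//].
rewrite subr_eq0 -natrX eq_sym pnatr_eq1 gtn_eqF //.
by rewrite -{1}(expn0 p) ltn_exp2l // totient_gt0.
Qed.

(** If p does not divide d, the hypothesis says h z = p * h (z ^+ p) for
    h = [msum 1 pole1 s] on the primitive d-th roots, and h vanishes by
    dilation.  If d = d' p with p prime to d', then for y primitive of order d'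
    the numbers y w, with w <> 1 a p-th root of unity, are primitive of order d,
    and the distribution relation turns the hypothesis into
    h y = p * h (y ^+ p); so h vanishes on the primitive d'-th roots, and then
    at z since h z = p * h (z ^+ p). *)
Lemma msum_strip_prime d p s : prime p -> ~~ (p ^ 2 %| d)%N ->
  all (coprime^~ p) s -> ~~ (d %| p * \prod_(q <- s) q)%N ->
  (forall z, d.-primitive_root z -> msum 1 pole1 (p :: s) z = 0) ->
  forall z, d.-primitive_root z -> msum 1 pole1 s z = 0.
Proof.
move=> p_pr p2_d co_sp d_n /= H z z_prim.
have {}H (u : C) : d.-primitive_root u ->
    msum 1 pole1 s u = p%:R * msum 1 pole1 s (u ^+ p).
  by move=> u_prim; apply: subr0_eq; rewrite -[RHS](H u u_prim) expr1.
have p_gt1 := prime_gt1 p_pr.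
have [p_d|] := boolP (p %| d)%N; last first.
  rewrite -prime_coprime // => co_pd.
  exact: prim_roots_dilation_eq0 p_gt1 co_pd H z z_prim.
have [d' def_d] := dvdnP p_d.
have co_d'p : coprime d' p.
  rewrite coprime_sym prime_coprime //; apply: contra p2_d => p_d'.
  by rewrite def_d expnS expn1 dvdn_mul.
have w_prim : p.-primitive_root (z ^+ d').
  by have := dvdn_prim_root z_prim p_d; rewrite {1}def_d mulnK // prime_gt0.
have zp_prim : d'.-primitive_root (z ^+ p).
  have d'_d : (d' %| d)%N by rewrite def_d dvdn_mulr.
  have := dvdn_prim_root z_prim d'_d; rewrite {1}def_d mulKn //.
  by rewrite -(ltn_pmul2r (prime_gt0 p_pr)) mul0n -def_d (prim_order_gt0 z_prim).
rewrite H // (prim_roots_dilation_eq0 p_gt1 _ _ zp_prim) ?mulr0 1?coprime_sym //.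
move=> y y_prim; have := @msum_distribution _ s p _ y w_prim co_sp.
have -> : y ^+ (p * \prod_(q <- s) q) != 1.
  rewrite -(prim_order_dvd y_prim) Gauss_dvdr //.
  by apply: contra d_n => d'_n; rewrite def_d mulnC dvdn_mul.
move/(_ isT).
case: p p_pr p_gt1 H w_prim co_d'p def_d {p2_d co_sp d_n p_d zp_prim} => //.
move=> p p_pr p_gt1 H w_prim co_d'p def_d.
(* The term w = 1 is set apart; all others equal p * h (y ^+ p). *)
rewrite big_ord_recl expr0 mulr1.
rewrite (eq_bigr (fun=> p.+1%:R * msum 1 pole1 s (y ^+ p.+1))); last first.
  move=> i _; rewrite H; last first.
    rewrite def_d; apply: prim_root_mul => //.
    rewrite prim_root_exp_coprime // coprime_sym prime_coprime // gtnNdvd //.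
  by rewrite exprMn -exprM mulnC exprM (prim_expr_order w_prim) expr1n mulr1.
rewrite sumr_const card_ord -[X in _ + X]mulr_natl => e.
apply: (addIr (p%:R * (p.+1%:R * msum 1 pole1 s (y ^+ p.+1)))).
by rewrite e -natr1; ring.
Qed.
End Stripping.

(** * Conjugate roots of unity *)

Section Conjugates.
Variable C : numFieldType.
Implicit Types (z : C) (P : {poly int}).

Lemma map_intr_ratr (L : numFieldType) P :
  map_poly ratr (map_poly intr P : {poly rat}) = map_poly intr P :> {poly L}.
Proof. by rewrite -map_poly_comp; apply: eq_map_poly => a; rewrite /= ratr_int. Qed.

Lemma root_Cyclotomic d z : d.-primitive_root z ->
  root (map_poly intr (Cyclotomic d)) z.
Proof.
move=> z_prim; have d_gt0 := prim_order_gt0 z_prim.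
have Phi_root e : (0 < e)%N -> root (map_poly intr (Cyclotomic e)) z -> z ^+ e = 1.
  move=> e_gt0 /rootP ez; apply/eqP; rewrite -subr_eq0.
  have /(congr1 (map_poly (intr : int -> C))) := prod_Cyclotomic e_gt0.
  rewrite (big_rem e) -?dvdn_divisors //= rmorphM rmorphB rmorph1 /= map_polyXn.
  by move/(congr1 (horner^~ z)); rewrite hornerM ez mul0r !hornerE /= => <-.
have /(congr1 (map_poly (intr : int -> C))) := prod_Cyclotomic d_gt0.
rewrite rmorphB rmorph1 /= map_polyXn rmorph_prod /=.
move/(congr1 (horner^~ z)); rewrite !hornerE (prim_expr_order z_prim) subrr horner_prod.
move/eqP; rewrite prodf_seq_eq0 => /hasP[e]; rewrite -dvdn_divisors //= => e_d e_root.
have e_gt0 := dvdn_gt0 d_gt0 e_d.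
suff -> : d = e by [].
apply/eqP; rewrite eqn_dvd e_d andbT (prim_order_dvd z_prim).
by rewrite Phi_root //.
Qed.

(** The lemma [minCpoly_cyclotomic] says that Phi_d is the minimal polynomial of
    each primitive d-th root of unity among the algebraic numbers.  To use it
    for a root z in another field, let g be the gcd over the rationals of Phi_d and P: it has
    the root z, so it is not constant and has a root among the algebraic
    numbers, which is a primitive d-th root of unity; thus Phi_d divides g. *)
Lemma root_conjugate P d z z' : d.-primitive_root z -> d.-primitive_root z' ->
  root (map_poly intr P) z -> root (map_poly intr P) z'.
Proof.
move=> z_prim z'_prim Pz; have d_gt0 := prim_order_gt0 z_prim.
have [w w_prim] := C_prim_root_exists d_gt0.
set PhiQ : {poly rat} := map_poly intr (Cyclotomic d).
have PhiQ_min (u : algC) Q : d.-primitive_root u -> root (map_poly ratr Q) u -> PhiQ %| Q.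
  move=> u_prim; have [q [q_min _] ->] := minCpolyP u.
  suff -> : PhiQ = q by [].
  apply: (map_poly_inj (ratr : {rmorphism rat -> algC})) => /=.
  by rewrite -q_min (minCpoly_cyclotomic u_prim) map_intr_ratr (Cintr_Cyclotomic u_prim).
suff PhiQ_P : PhiQ %| map_poly intr P.
  have : (map_poly ratr PhiQ : {poly C}) %| map_poly ratr (map_poly intr P).
    by rewrite dvdp_map.
  by rewrite !map_intr_ratr => /root_dvdp->; rewrite ?root_Cyclotomic.
pose g := gcdp PhiQ (map_poly intr P).
have gz : root (map_poly ratr g) z.
  by rewrite gcdp_map !map_intr_ratr root_gcd Pz root_Cyclotomic.
have PhiQ0 : PhiQ != 0.
  rewrite -size_poly_eq0 size_map_poly_id0 ?size_Cyclotomic //.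
  by rewrite (monicP (Cyclotomic_monic d)).
have g0 : g != 0 by rewrite gcdp_eq0 negb_and PhiQ0.
have g_size : size (map_poly ratr g : {poly algC}) != 1%N.
  rewrite size_map_poly -(size_map_poly (ratr : {rmorphism rat -> C})).
  apply: contraL gz => /eqP/eqP/size_poly1P[c c0 ->].
  by rewrite rootC.
have [u gu] := closed_rootP _ g_size.
have u_prim : d.-primitive_root u.
  have : root (map_poly ratr PhiQ) u.
    by apply: root_dvdp gu; rewrite dvdp_map dvdp_gcdl.
  by rewrite map_intr_ratr (Cintr_Cyclotomic w_prim) root_cyclotomic.
exact: dvdp_trans (PhiQ_min u g u_prim gu) (dvdp_gcdr _ _).
Qed.

End Conjugates.

(** * Squarefree integers and multiplicities *)

Section Primes.

Lemma coprime_prod_primes p s : prime p -> all prime s -> p \notin s ->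
  coprime p (\prod_(q <- s) q)%N.
Proof.
move=> p_pr; elim: s => [|q s IHs] /=; first by rewrite big_nil coprimen1.
move=> /andP[q_pr s_pr]; rewrite inE negb_or big_cons coprimeMr => /andP[pq p_s].
by rewrite IHs // andbT prime_coprime // dvdn_prime2.
Qed.

Lemma sqr_prod_primes_dvd d s : uniq s -> all prime s ->
  all (fun p => p ^ 2 %| d)%N s -> ((\prod_(p <- s) p) ^ 2 %| d)%N.
Proof.
elim: s => [|p s IHs] /=; first by rewrite big_nil dvd1n.
move=> /andP[p_s s_uniq] /andP[p_pr s_pr] /andP[p_d s_d].
rewrite big_cons expnMn Gauss_dvd ?p_d ?IHs //.
by rewrite coprimeXl // coprimeXr // coprime_prod_primes.
Qed.

Lemma squarefree_prod_primes n : (0 < n)%N -> squarefree n ->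
  n = (\prod_(p <- primes n) p)%N.
Proof.
move=> n_gt0 n_sqf; rewrite {1}(prod_prime_decomp n_gt0) prime_decompE big_map /=.
rewrite !big_seq; apply: eq_bigr => p p_n.
suff -> : logn p n = 1%N by rewrite expn1.
apply/eqP; rewrite eqn_leq logn_gt0 p_n andbT leqNgt; apply/negP => p2.
have p_pr : prime p by move: p_n; rewrite mem_primes => /andP[].
have := n_sqf p; rewrite pfactor_dvdn // => /(_ p2) p1.
by rewrite p1 in p_pr.
Qed.

Lemma squarefree_dvd n d : (d %| n)%N -> squarefree n -> squarefree d.
Proof. by move=> d_n n_sqf m m_d; apply: n_sqf; apply: dvdn_trans d_n. Qed.

Lemma squarefree_coprime n d :
  (0 < n)%N -> (d %| n)%N -> squarefree n -> coprime d (n %/ d).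
Proof.
move=> n_gt0 d_n n_sqf; apply/eqP; apply: n_sqf.
by rewrite -{2}(divnK d_n) mulnC expnS expn1 dvdn_mul ?dvdn_gcdl ?dvdn_gcdr.
Qed.

End Primes.

Section RootsOfPolys.
Variable F : numFieldType.
Implicit Types (a : F) (P : {poly F}).

Lemma sqr_dvd_root P a : root P a -> root P^`() a -> ('X - a%:P) ^+ 2 %| P.
Proof.
rewrite -dvdp_XsubCl => /dvdpP[Q ->].
rewrite derivM derivXsubC mulr1 rootE !hornerE subrr mulr0 add0r => Qa.
by rewrite expr2 dvdp_mul // dvdp_XsubCl rootE Qa.
Qed.

Lemma mup_eq1 P a : root P a -> ~~ root P^`() a -> mup a P = 1%N.
Proof.
move=> Pa P'a; have P0 : P != 0 by apply: contraNneq P'a => ->; rewrite deriv0 root0.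
apply/eqP; rewrite eqn_leq mup_leq // mup_geq // expr1 dvdp_XsubCl Pa andbT.
apply: contra P'a => /dvdpP[Q ->].
rewrite rootE expr2 !(derivM, derivXsubC, hornerXsubC, hornerD, hornerM) subrr.
by apply/eqP; ring.
Qed.

Lemma mup_eq2 P a :
  root P a -> root P^`() a -> ~~ root P^`()^`() a -> mup a P = 2%N.
Proof.
move=> Pa P'a P''a.
have P0 : P != 0 by apply: contraNneq P''a => ->; rewrite !deriv0 root0.
apply/eqP; rewrite eqn_leq mup_leq // mup_geq // sqr_dvd_root // andbT.
apply: contra P''a => /dvdpP[Q ->].
rewrite rootE exprS expr2 !(derivM, derivXsubC, derivD, derivC).
rewrite !(hornerXsubC, hornerD, hornerM) subrr.
by apply/eqP; ring.
Qed.

End RootsOfPolys.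

(** * Multiplicity of the roots of unity *)

Section Multiplicity.
Variable C : numFieldType.
Implicit Types (z : C).

Notation F n := (map_poly intr (coprime_poly n) : {poly C}).

Lemma coprime_poly_at1 n : (F n).[1] = (totient n)%:R.
Proof.
rewrite totient_count_coprime /coprime_poly rmorph_sum horner_sum natr_sum big_mkcond /=.
apply: eq_bigr => a _; rewrite coprime_sym.
by case: coprime; rewrite //= map_polyXn hornerXn expr1n.
Qed.

(** For n = p m with z ^+ m <> 1 and z ^+ n = 1, the recursion reduces to
    F_n(z) = - F_m(z ^+ p); repeating this brings z down to 1. *)
Lemma coprime_poly_root_dvd_neq0 s e z : uniq s -> all prime s -> (0 < e)%N ->
  coprime (\prod_(p <- s) p)%N e -> (\prod_(p <- s) p)%N.-primitive_root z ->
  ~~ root (F (\prod_(p <- s) p * e)%N) z.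
Proof.
move=> + + e_gt0; elim: s z => [|p s IHs] z /=.
  rewrite big_nil => _ _ _ /prim_expr_order; rewrite expr1 mul1n => ->.
  by rewrite rootE coprime_poly_at1 pnatr_eq0 -lt0n totient_gt0.
move=> /andP[p_s s_uniq] /andP[p_pr s_pr]; rewrite big_cons.
set P := (\prod_(q <- s) q)%N.
rewrite coprimeMl => /andP[co_pe co_Pe] z_prim.
have P_gt0 : (0 < P)%N.
  by move: (prim_order_gt0 z_prim); rewrite muln_gt0 => /andP[].
have co_pPe : coprime p (P * e) by rewrite coprimeMr co_pe coprime_prod_primes.
have zp_prim : P.-primitive_root (z ^+ p).
  by have := dvdn_prim_root z_prim (dvdn_mull p (dvdnn P)); rewrite mulnK.
have zPe : z ^+ (P * e) - 1 != 0.
  rewrite subr_eq0 -(prim_order_dvd z_prim) mulnC dvdn_pmul2l //.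
  by apply/negP => p_e; move: co_pe; rewrite prime_coprime // p_e.
have zpPe : z ^+ (p * (P * e)) = 1.
  by rewrite mulnA exprM (prim_expr_order z_prim) expr1n.
have /(congr1 (map_poly (intr : int -> C))) := coprime_poly_mul_prime p_pr co_pPe.
rewrite rmorphB !rmorphM !rmorphB /= !rmorph1 !map_polyXn map_comp_poly map_polyXn /=.
move/(congr1 (horner^~ z)).
rewrite !(hornerD, hornerN, hornerM, horner_comp, hornerXn, hornerC) zpPe subrr mulr0 add0r.
rewrite -mulNr => /(mulIf zPe) Fz.
by rewrite -mulnA rootE Fz oppr_eq0; apply: IHs.
Qed.

Lemma squarefree_primitive_root_dvd n d z : (0 < n)%N -> squarefree n -> (d %| n)%N ->
  d.-primitive_root z -> ~~ root (F n) z.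
Proof.
move=> n_gt0 n_sqf d_n z_prim; have d_gt0 := prim_order_gt0 z_prim.
have def_d := squarefree_prod_primes d_gt0 (squarefree_dvd d_n n_sqf).
rewrite -(divnK d_n) mulnC {1}def_d.
apply: coprime_poly_root_dvd_neq0; rewrite -?def_d ?primes_uniq //.
- by apply/allP => p; rewrite mem_primes => /andP[].
- by rewrite divn_gt0 // dvdn_leq.
- exact: squarefree_coprime.
Qed.

Lemma msum_strip_primes d s1 s2 : uniq (s1 ++ s2) -> all prime (s1 ++ s2) ->
  all (fun p => ~~ (p ^ 2 %| d)%N) s1 -> ~~ (d %| \prod_(p <- s1 ++ s2) p)%N ->
  (forall z, d.-primitive_root z -> msum 1 pole1 (s1 ++ s2) z = 0) ->
  forall z, d.-primitive_root z -> msum 1 pole1 s2 z = 0.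
Proof.
elim: s1 => // p s1 IHs /= /andP[p_s s_uniq] /andP[p_pr s_pr] /andP[p2_d s1_d].
rewrite big_cons => d_n H; apply: IHs => //.
  by apply: contra d_n => d_n; rewrite dvdn_mull.
apply: msum_strip_prime H => //.
apply/allP => q q_s; have q_pr := allP s_pr q q_s.
by rewrite prime_coprime // dvdn_prime2 //; apply: contraNneq p_s => <-.
Qed.

Lemma pole1_neq0 (x : C) : x != 0 -> x != 1 -> pole1 x != 0.
Proof.
move=> x0 x1; rewrite /pole1 oppr_eq0 mulf_neq0 // invr_neq0 // expf_neq0 //.
by rewrite subr_eq0.
Qed.

Lemma norm_unity_root (z : C) n : (0 < n)%N -> z ^+ n = 1 -> `|z| = 1.
Proof.
move=> n_gt0 zn; apply/eqP; rewrite -(@pexpr_eq1 _ _ n) // -normrX zn.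
by rewrite normr1.
Qed.

(** With N the product of s, the hypotheses make N ^ 2 divide d, so that z w is
    a primitive d-th root of unity for all N-th roots of unity w. *)
Lemma msum_square_primes d s z : uniq s -> all prime s ->
  all (fun p => p ^ 2 %| d)%N s -> d != 1%N -> (s != [::]) ==> (d != 4)%N ->
  d.-primitive_root z ->
  (forall u : C, d.-primitive_root u -> msum 1 pole1 s u = 0) -> False.
Proof.
move=> s_uniq s_pr s_d d1 d4 z_prim H; have d_gt0 := prim_order_gt0 z_prim.
have z0 : z != 0 by rewrite (prim_root_eq0 z_prim) gtn_eqF.
have [s0|s0] := eqVneq s [::].
  have := H z z_prim; rewrite s0 /=; apply/eqP/pole1_neq0 => //.
  by rewrite -[z]expr1 -(prim_order_dvd z_prim) dvdn1.
rewrite s0 /= in d4.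
set N := (\prod_(p <- s) p)%N.
have N2_d : (N ^ 2 %| d)%N by apply: sqr_prod_primes_dvd.
have N_gt1 : (1 < N)%N.
  rewrite /N; case: s s0 s_pr {s_uniq s_d H N N2_d} => // p s _ /= /andP[p_pr s_pr].
  rewrite big_cons (leq_trans (prime_gt1 p_pr)) // leq_pmulr //.
  rewrite big_seq prodn_cond_gt0 // => q q_s.
  by rewrite prime_gt0 // (allP s_pr).
have N_d : (N %| d)%N by rewrite (dvdn_trans _ N2_d) // expnS dvdn_mulr.
have w_prim := dvdn_prim_root z_prim N_d; set M := (d %/ N)%N in w_prim.
have N_M : (N %| M)%N by rewrite /M dvdn_divRL // -[(N * N)%N]/(N ^ 2)%N.
(* z w is z ^+ (1 + M i), and 1 + M i is prime to M, hence to d | M * M. *)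
have zw_prim i : d.-primitive_root (z * (z ^+ M) ^+ i).
  rewrite -exprM -exprS prim_root_exp_coprime //.
  have : coprime (M * i).+1 (M * M).
    by rewrite coprimeMr andbb -addn1 coprime_sym mulnC /coprime gcdnMDl gcdn1.
  by apply: coprime_dvdr; rewrite -(divnK N_d) dvdn_mul.
have y1 : z ^+ N != 1.
  rewrite -(prim_order_dvd z_prim); apply/negP => d_N.
  have := dvdn_leq (ltnW N_gt1) (dvdn_trans N2_d d_N).
  by rewrite leqNgt expnS expn1 ltn_Pmulr // ltnW.
have s_N : all (fun p => (1 < p) && (p %| N))%N s.
  apply/allP => p p_s; rewrite prime_gt1 ?(allP s_pr) //=.
  by rewrite /N (big_rem p) //= dvdn_mulr.
have := msum_twisted_sum w_prim N_gt1 s_N y1.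
rewrite big1 => [/esym/eqP|i _]; last by rewrite H ?mulr0.
rewrite !mulf_eq0 (negbTE z0) pnatr_eq0 gtn_eqF 1?ltnW //= orbF /pole1_coef oppr_eq0.
set y := z ^+ N in y1 *.
have y1' : 1 - y != 0 by rewrite subr_eq0 eq_sym.
move=> /eqP c1; have {c1} c1 : 1 + (N.-1)%:R * y = 0.
  have -> : 1 + (N.-1)%:R * y
    = (1 - y) ^+ 2 * (1%:R / (1 - y) + N%:R * y / (1 - y) ^+ 2).
    by rewrite -(prednK (ltnW N_gt1)) -natr1; field.
  by rewrite c1 mulr0.
have yE : (N.-1)%:R * y = -1 by apply: (addrI 1); rewrite c1 subrr.
have : `|(N.-1)%:R * y| = 1 by rewrite yE normrN1.
rewrite normrM (@norm_unity_root y d) //; last first.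
  by rewrite /y -exprM mulnC exprM (prim_expr_order z_prim) expr1n.
rewrite mulr1 normr_nat => /eqP; rewrite pnatr_eq1 => /eqP N1.
have N2 : N = 2%N by rewrite -(prednK (ltnW N_gt1)) N1.
rewrite N1 mul1r /y N2 in yE.
case/negP: d4; rewrite eqn_dvd; move: N2_d; rewrite N2 => ->.
by rewrite andbT (prim_order_dvd z_prim) (exprM z 2 2) yE sqrrN expr1n.
Qed.

Lemma sqr_eqN1_odd (x : C) p : odd p -> x ^+ 2 = -1 -> x ^+ p = (-1) ^+ p./2 * x.
Proof.
move=> p_odd x2; rewrite -[p in LHS]odd_double_half p_odd exprD mulrC.
by rewrite -muln2 mulnC exprM x2.
Qed.

Lemma sqr_eqN1_neq1 (x : C) : x ^+ 2 = -1 -> x - 1 != 0.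
Proof.
move=> x2; rewrite subr_eq0; apply/eqP => x1; move/eqP: x2.
by rewrite x1 expr1n -subr_eq0 opprK -(natrD _ 1 1) pnatr_eq0.
Qed.

(** The base case is pole1 x = 1 / 2 and pole1 (-1) = 1 / 4; the odd powers of a
    square root of -1 are again square roots of -1. *)
Lemma msum1_order4 s (x : C) : all odd s -> x ^+ 2 = -1 ->
  msum 1 pole1 (s ++ [:: 2]) x = 0.
Proof.
elim: s x => [|p s IHs] x /=.
  move=> _ x2; have x1 := sqr_eqN1_neq1 x2.
  have n2 : 2%:R != 0 :> C by rewrite pnatr_eq0.
  have -> : pole1 x = 2%:R^-1.
    have e : (x - 1) ^+ 2 = - 2%:R * x by rewrite sqrrB x2; ring.
    have x0 : x != 0.
      by apply: contra_eq_neq x2 => ->; rewrite expr0n eq_sym oppr_eq0 oner_eq0.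
    by rewrite /pole1 e; field.
  by rewrite x2 /pole1; field.
move=> /andP[p_odd s_odd] x2; rewrite !IHs ?mulr0 ?subr0 //.
by rewrite exprAC x2 -signr_odd p_odd.
Qed.

(** As [pole2 (-1)] = 0, the base case is pole2 x = x / 2.  An odd prime p
    multiplies the constant by 1 - p ^ 2 or 1 + p ^ 2, since x ^+ p = x
    or - x. *)
Lemma msum2_order4 s : all (fun p => odd p && (1 < p))%N s ->
  exists2 c : C, c != 0 &
    forall x, x ^+ 2 = -1 -> msum 2 pole2 (s ++ [:: 2]) x = c * x.
Proof.
have n2 : 2%:R != 0 :> C by rewrite pnatr_eq0.
elim: s => [_|p s IHs] /=.
  exists 2%:R^-1; first by rewrite invr_neq0.
  move=> x x2; have x1 := sqr_eqN1_neq1 x2.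
  have e : (x - 1) ^+ 3 = 2%:R * (x + 1).
    rewrite exprS sqrrB x2; transitivity (2%:R * x - 2%:R * x ^+ 2); first by ring.
    by rewrite x2; ring.
  have x1' : x + 1 != 0.
    by apply: contra_neq (expf_neq0 3 x1) => x0; rewrite e x0 mulr0.
  by rewrite x2 /pole2 e; field.
move=> /andP[/andP[p_odd p_gt1] /IHs[c c0 Hc]].
exists (c * (1 - p%:R ^+ 2 * (-1) ^+ p./2)).
  rewrite mulf_neq0 // subr_eq0 eq_sym; apply/eqP => e.
  have := congr1 (fun u => u ^+ 2) e.
  rewrite exprMn expr1n -[_ ^+ p./2 ^+ 2]exprM mulnC exprM sqrrN expr1n expr1n mulr1.
  by move/eqP; rewrite -!natrX pnatr_eq1 -expnM gtn_eqF // -(exp1n 4) ltn_exp2r.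
move=> x x2; rewrite Hc // Hc; last by rewrite exprAC x2 -signr_odd p_odd.
by rewrite (sqr_eqN1_odd p_odd x2); ring.
Qed.

Lemma horner_euler_op (P : {poly C}) z : (euler_op P).[z] = z * P^`().[z].
Proof. by rewrite euler_op.unlock hornerM hornerX. Qed.

(** The primes dividing n are listed so that those to be stripped, whose square
    does not divide d, come first. *)
Lemma coprime_poly_simple_root n d z :
  (0 < n)%N -> squarefree n -> ~~ (d %| n)%N ->
  d.-primitive_root z -> ~~ odd n ==> (d != 4)%N ->
  root (F n) z -> ~~ root (F n)^`() z.
Proof.
move=> n_gt0 n_sqf d_n z_prim d4 Fz; apply/negP => F'z.
pose sq p := (p ^ 2 %| d)%N.
pose s2 := [seq p <- primes n | sq p]; pose s1 := [seq p <- primes n | predC sq p].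
have s_primes : perm_eq (s1 ++ s2) (primes n).
  by rewrite perm_catC; apply/permPl/perm_filterC.
have s_uniq : uniq (s1 ++ s2) by rewrite (perm_uniq s_primes) primes_uniq.
have s_pr : all prime (s1 ++ s2).
  by rewrite (perm_all _ s_primes); apply/allP => p; rewrite mem_primes => /andP[].
have s_n : (\prod_(p <- s1 ++ s2) p)%N = n.
  by rewrite (perm_big _ s_primes) /= -squarefree_prod_primes.
have H u : d.-primitive_root u -> msum 1 (@pole1 C) (s1 ++ s2) u = 0.
  move=> u_prim.
  have un : u ^+ n != 1 by rewrite -(prim_order_dvd u_prim).
  have [] := @coprime_poly_msum C (s1 ++ s2) u s_uniq s_pr; rewrite s_n //.
  rewrite horner_euler_op (rootP (root_conjugate z_prim u_prim Fz)).
  move: F'z; rewrite !deriv_map => F'z.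
  rewrite (rootP (root_conjugate z_prim u_prim F'z)) mulr0.
  have un0 : u ^+ n - 1 != 0 by rewrite subr_eq0.
  move/esym/eqP; rewrite mulf_eq0 (negbTE un0) => /eqP -> /esym/eqP.
  by rewrite mulr0 add0r mulf_eq0 (negbTE un0) => /eqP.
have {}H : forall u, d.-primitive_root u -> msum 1 (@pole1 C) s2 u = 0.
  by apply: msum_strip_primes H; rewrite ?s_n // filter_all.
apply: msum_square_primes z_prim H.
- by rewrite filter_uniq // primes_uniq.
- by move: s_pr; rewrite all_cat => /andP[].
- exact: filter_all.
- by apply: contraNneq d_n => ->; apply: dvd1n.
apply/implyP => s2_n0.
have [n_odd|n_even] := boolP (odd n); last exact: implyP d4 n_even.
(* For n odd and d = 4, no prime dividing n has a square dividing d. *)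
apply: contraNneq s2_n0 => d_4; rewrite /s2 -(filter_pred0 (primes n)); apply/eqP.
apply: eq_in_filter => p; rewrite mem_primes => /and3P[p_pr _ p_n] /=.
apply/negbTE/negP.
rewrite /sq d_4 (@dvdn_pexp2r p 2 2) // dvdn_prime2 // => /eqP p2.
by move: p_n; rewrite p2 dvdn2 n_odd.
Qed.

Lemma coprime_poly_double_root n z : (0 < n)%N -> squarefree n -> ~~ odd n ->
  4.-primitive_root z -> root (F n) z ->
  root (F n)^`() z /\ ~~ root (F n)^`()^`() z.
Proof.
move=> n_gt0 n_sqf n_even z_prim Fz.
have z4 := prim_expr_order z_prim.
have z2 : z ^+ 2 = -1.
  apply/eqP; move/eqP: z4; rewrite (exprM z 2 2) sqrf_eq1 => /orP[|//].
  by rewrite -(prim_order_dvd z_prim).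
have z0 : z != 0 by rewrite (prim_root_eq0 z_prim).
pose s := [seq p <- primes n | odd p].
have n_2 : 2 \in primes n by rewrite mem_primes /= n_gt0 dvdn2.
have s_primes : perm_eq (s ++ [:: 2]) (primes n).
  apply: uniq_perm => [||p]; [|exact: primes_uniq|].
    by rewrite cat_uniq filter_uniq ?primes_uniq //= mem_filter.
  rewrite mem_cat mem_filter inE.
  have [-> //|p2] := eqVneq p 2; rewrite orbF.
  case: (boolP (p \in primes n)) => [|_]; rewrite ?andbF // andbT mem_primes.
  by case/and3P=> p_pr _ _; case: (even_prime p_pr) => // /eqP; rewrite (negbTE p2).
have s_uniq : uniq (s ++ [:: 2]) by rewrite (perm_uniq s_primes) primes_uniq.
have s_pr : all prime (s ++ [:: 2]).
  by rewrite (perm_all _ s_primes); apply/allP => p; rewrite mem_primes => /andP[].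
have s_n : (\prod_(p <- s ++ [:: 2]) p)%N = n.
  by rewrite (perm_big _ s_primes) /= -squarefree_prod_primes.
have zn : z ^+ n - 1 != 0.
  rewrite subr_eq0 -(prim_order_dvd z_prim); apply/negP => /(n_sqf 2).
  by [].
have [] := @coprime_poly_msum C _ z s_uniq s_pr; rewrite s_n; first by rewrite -subr_eq0.
rewrite (rootP Fz) => /esym/eqP; rewrite mulf_eq0 (negbTE zn) => /eqP ->.
have s_odd : all odd s by apply: filter_all.
rewrite !(msum1_order4 s_odd z2) !mulr0 !add0r => F1 F2.
have {}F1 : (F n)^`().[z] = 0.
  by move/eqP: F1; rewrite horner_euler_op mulf_eq0 (negbTE z0) => /eqP.
split; first exact/eqP.
apply/negP => /rootP F''z; move: F2.
rewrite horner_euler_op euler_op.unlock derivM derivX mul1r.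
rewrite hornerD hornerM hornerX F1 F''z.
have [|c c0 msum2] := @msum2_order4 s.
  apply/allP => p p_s; rewrite (allP s_odd) // prime_gt1 // (allP s_pr) //.
  by rewrite mem_cat p_s.
rewrite msum2 // mulr0 addr0 mulr0 => /esym/eqP.
by rewrite !mulf_eq0 (negbTE zn) (negbTE c0) (negbTE z0).
Qed.

Theorem coprime_poly_mup n d z : (1 < n)%N -> squarefree n -> (0 < d)%N ->
  d.-primitive_root z -> root (F n) z ->
  mup z (F n) = if (d == 4) && ~~ odd n then 2%N else 1%N.
Proof.
move=> n_gt1 n_sqf d_gt0 z_prim Fz; have n_gt0 := ltnW n_gt1.
have d_n : ~~ (d %| n)%N.
  by apply: contraL Fz => d_n; apply: squarefree_primitive_root_dvd d_n z_prim.
case: ifP => [/andP[/eqP d4 n_even]|d4].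
  rewrite d4 in z_prim.
  by have [] := coprime_poly_double_root n_gt0 n_sqf n_even z_prim Fz; apply: mup_eq2.
apply: mup_eq1 => //; apply: coprime_poly_simple_root z_prim _ Fz => //.
by move/negbT: d4; rewrite negb_and orbC implybE.
Qed.
End Multiplicity.

Local Open Scope complex_scope.

Theorem theorem2p29 (R : realType) (n d : nat) (zeta : R[i])
    (n_gt1 : (1 < n)%N) (n_sqf : squarefree n)
    (d_gt0 : (0 < d)%N) (zeta_prim : d.-primitive_root zeta)
    (zeta_root : root (map_poly intr (coprime_poly n)) zeta) :
  [/\ d <> 4%N -> mup zeta (map_poly intr (coprime_poly n)) = 1%N,
      d = 4%N -> odd n -> mup zeta (map_poly intr (coprime_poly n)) = 1%N
    & d = 4%N -> ~~ odd n -> mup zeta (map_poly intr (coprime_poly n)) = 2%N].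
Proof.
have -> := coprime_poly_mup n_gt1 n_sqf d_gt0 zeta_prim zeta_root.
by split=> [/eqP/negbTE -> // | -> -> | -> ->].
Qed.
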